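(* Let $p<q$ be primes with $p$ odd, let $n=q$, and consider the finite non-abelian group $T_{4n}\times C_p$ of order $4qp$. Let $t$ be the integer such that the number of cyclic subgroups of $T_{4n}\times C_p$ equals $|T_{4n}\times C_p|-t$. Then $t=2q(2p-1)-8$; that is, the number of cyclic subgroups of $T_{4q}\times C_p$ is $$4pq-\bigl(2q(2p-1)-8\bigr).$$
   Context: $T_{4n}$ denotes the dicyclic group of order $4n$, $T_{4n}=\langle \alpha,\beta \mid \alpha^{2n}=e,\ \alpha^n=\beta^2,\ \beta\alpha\beta^{-1}=\alpha^{-1}\rangle$. $C_p$ is the cyclic group of order $p$. The trivial subgroup is counted as cyclic. *)

(* Defs.v *)
From mathcomp Require Import all_boot all_order all_algebra all_fingroup all_solvable.

Set Implicit Arguments.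
Unset Strict Implicit.
Unset Printing Implicit Defensive.

Local Open Scope group_scope.

(* T is a dicyclic group T_{4n}.  For n > 0 the abstract group with this
   presentation is finite (of order 4n), so [\isog Grp] means that T is
   isomorphic to it. *)
Definition is_dicyclic (n : nat) (gT : finGroupType) (T : {group gT}) : Prop :=
  T \isog Grp (a : b :
    a ^+ (2 * n), a ^+ n = b ^+ 2, b * a * b^-1 = a^-1).

Definition cyclic_subgroups (gT : finGroupType) (G : {group gT}) :
  {set {group gT}} := [set H in subgroups G | cyclic H].

(* Main.v *)
(* As p is coprime to 4q, cyclic subgroups of T * C are products of cyclic
   subgroups of T and of C; C has two.  In T, the cyclic subgroup A = <a> of
   order 2q has one subgroup for each of the four divisors of 2q, and each of
   the 2q elements outside A squares to a^q, hence has order 4; they generate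
   q further subgroups, with two generators each.  The total is 2(q + 4). *)

Require Import Defs.
From mathcomp Require Import all_boot all_order all_algebra all_fingroup all_solvable.
From mathcomp Require Import zify.

Set Implicit Arguments.
Unset Strict Implicit.
Unset Printing Implicit Defensive.

Import Order.TTheory GRing.Theory Num.Theory.

Section Divisors.

Local Open Scope nat_scope.

Lemma size_divisors_prime (p : nat) : prime p -> size (divisors p) = 2.
Proof.
move=> p_pr; rewrite -(@perm_size _ [:: 1; p]) //; apply: uniq_perm => [||d].
- by rewrite /= inE andbT neq_ltn prime_gt1.
- exact: divisors_uniq.
rewrite -dvdn_divisors ?prime_gt0 // !inE; apply/orP/idP => [[]/eqP->|d_dvd] //.
by apply/orP; case/primeP: p_pr => _; apply.
Qed.

Lemma size_divisors_double_prime (q : nat) :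
  prime q -> odd q -> size (divisors (2 * q)) = 4.
Proof.
move=> q_pr q_odd; have q_gt2 := odd_prime_gt2 q_odd q_pr.
rewrite -(@perm_size _ [:: 1; 2; q; 2 * q]) //; apply: uniq_perm => [||d].
- by rewrite /= !inE; lia.
- exact: divisors_uniq.
rewrite -dvdn_divisors ?muln_gt0 ?prime_gt0 // !inE.
apply/idP/idP => [|d_dvd].
  by case/or4P=> /eqP->; rewrite ?dvd1n ?dvdnn
     ?(dvdn_mulr _ (dvdnn 2)) ?(dvdn_mull _ (dvdnn q)).
have [_ dvd2] := @primeP 2 isT.
(* If q divides d, then d = kq with k dividing 2; otherwise d is coprime to q and divides 2. *)
have [q_d | ] := boolP (q %| d).
  have [k def_d] := dvdnP q_d; move: d_dvd; rewrite def_d dvdn_pmul2r ?prime_gt0 //.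
  by case/dvd2/pred2P=> ->; rewrite ?mul1n eqxx ?orbT.
rewrite -prime_coprime // coprime_sym => d_q; move: d_dvd; rewrite Gauss_dvdl //.
by case/dvd2/pred2P=> ->.
Qed.

End Divisors.

Section CyclicSubgroups.

Local Open Scope group_scope.

Lemma dicyclic_gen (n : nat) (gT : finGroupType) (T : {group gT}) :
  is_dicyclic n T -> exists a b : gT,
    [/\ <[a]> <*> <[b]> = T, a ^+ (2 * n) = 1, a ^+ n = b ^+ 2
      & b * a * b^-1 = a^-1].
Proof.
move/isoGrp_hom/existsP=> [[a b]] /=; rewrite !xpair_eqE /=.
by case/and4P=> /eqP defT /eqP a2n /eqP b2 /eqP ba; exists a, b.
Qed.

(* C_4 (via a |-> g^2, b |-> g, which needs n odd) and the dihedral group of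
   order 2n are both quotients of T, so 4 and n divide #|T|. *)
Lemma dicyclic_card_dvdn (n : nat) (gT : finGroupType) (T : {group gT}) :
  odd n -> (1 < n)%N -> is_dicyclic n T -> (4 * n %| #|T|)%N.
Proof.
move=> n_odd n_gt1 dicT; rewrite Gauss_dvd; last first.
  by rewrite -[4]/(2 ^ 2)%N coprimeXl // coprime2n.
apply/andP; split.
  have o4 : #[Zp1 : 'Z_4] = 4 by rewrite order_Zp1.
  rewrite -{1}o4 orderE; apply: card_homg; rewrite dicT.
  apply/existsP; exists (Zp1 ^+ 2, Zp1); rewrite /= !xpair_eqE /=.
  rewrite -!expgM eqEsubset join_subG cycleX subxx joing_subr /=.
  have n4 : (2 * n = 2 %[mod 4])%N by lia.
  rewrite !eq_expg_mod_order o4 n4.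
  by rewrite -order_dvdn o4 mulnA dvdn_mulr.
suff: (n.*2 %| #|T|)%N by apply: dvdn_trans; rewrite -muln2 dvdn_mulr.
rewrite -(card_dihedral n_gt1); apply: card_homg; rewrite dicT.
have /isoGrp_hom/existsP[[x y]] /= := Grp_dihedral n_gt1.
rewrite !xpair_eqE => /and4P[/eqP defD /eqP xn /eqP y2 /eqP xy].
(* The dihedral generators satisfy the dicyclic relations: x^n and y^2 are both trivial, and y =
   y^-1 identifies the two forms of the conjugation relation. *)
apply/existsP; exists (x, y); rewrite /= !xpair_eqE defD eqxx.
rewrite mulnC expgM xn y2 expg1n eqxx /=.
have yV : y = y^-1 by apply/eqP; rewrite eq_sym eq_invg_mul -expg2 y2.
by rewrite -yV -xy conjgE -yV mulgA eqxx.
Qed.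

(** With A = <a>, the relations only bound T from above: [#[a]] divides 2n and the index of A
    divides 2. Since 4n divides [#|T|], both bounds are attained. *)
Lemma dicyclic_structure (n : nat) (gT : finGroupType) (T : {group gT}) :
    odd n -> (1 < n)%N -> is_dicyclic n T ->
  exists A : {group gT}, [/\ A \subset T, cyclic A, #|A| = (2 * n)%N,
    #|T| = (4 * n)%N & {in T :\: A, forall x, #[x] = 4}].
Proof.
move=> n_odd n_gt1 dicT; have n_gt0 := ltnW n_gt1.
have dvdT := dicyclic_card_dvdn n_odd n_gt1 dicT.
have [a [b [defT a2n b2 ba]]] := dicyclic_gen dicT.
have Ta : a \in T by rewrite -defT mem_gen // inE cycle_id.
have Tb : b \in T by rewrite -defT mem_gen // inE cycle_id orbT.
have sAT : <[a]> \subset T by rewrite cycle_subG.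
have aJ i : (a ^+ i) ^ b^-1 = (a ^+ i)^-1.
  by rewrite conjXg conjgE invgK mulgA ba expgVn.
have nAb : b \in 'N(<[a]>).
  rewrite -groupV; apply/normP/eqP; rewrite eqEcard cardJg leqnn andbT.
  by rewrite -cycleJ cycle_subG -[a]expg1 aJ groupV mem_cycle.
have Ab2 : b ^+ 2 \in <[a]> by rewrite -b2 mem_cycle.
(* T/<a> is generated by the coset of b, whose square is trivial. *)
have iTA : #|T : <[a]>| %| 2.
  rewrite -defT -card_quotient ?join_subG ?normG ?cycle_subG //.
  rewrite quotientYidl ?cycle_subG // quotient_cycle // -orderE order_dvdn.
  by rewrite -morphX //= coset_id.
have oa : #[a] = (2 * n)%N.
  have [k_gt0 a_dvd] : (0 < #[a])%N /\ #[a] %| 2 * n by rewrite order_dvdn a2n.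
  apply/eqP; rewrite eqn_leq dvdn_leq ?muln_gt0 ?n_gt0 //=.
  rewrite -(@leq_pmul2r 2) // mulnAC dvdn_leq ?muln_gt0 ?k_gt0 //.
  by apply: dvdn_trans dvdT _; rewrite -(Lagrange sAT) -orderE dvdn_pmul2l.
have i2 : #|T : <[a]>| = 2.
  apply/eqP; rewrite eqn_dvd iTA -(@dvdn_pmul2l (2 * n)) ?muln_gt0 //.
  by rewrite -{2}oa mulnAC orderE Lagrange.
exists <[a]>%G; split; rewrite ?cycle_cyclic // -?orderE //.
  by rewrite -(Lagrange sAT) -orderE oa i2 mulnAC.
have TAb : b \in T :\: <[a]>.
  rewrite inE Tb andbT; apply/negP=> Ab; move: i2.
  by rewrite -defT (joing_idPl _) ?cycle_subG // indexgg.
move=> x; rewrite -(rcoset_index2 sAT i2 TAb) => /rcosetP[_ /cycleP[i ->] ->].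
(* Moving b past a^i inverts a^i, so the powers of a cancel and b^2 = a^n remains. *)
have x2 : (a ^+ i * b) ^+ 2 = a ^+ n.
  have ba_i : b * a ^+ i = (a ^+ i)^-1 * b.
    by rewrite -aJ conjgE invgK -!mulgA mulVg mulg1.
  by rewrite expg2 mulgA -(mulgA _ b) ba_i !mulgA mulgV mul1g b2.
have an : a ^+ n != 1.
  by rewrite -order_dvdn oa gtnNdvd // ltn_Pmull.
have : #[a ^+ i * b] %| (2 ^ 2)%N.
  by rewrite order_dvdn (expgM _ 2 2) x2 -expgM mulnC a2n.
(* The order is 1, 2 or 4; the first two would make the square a^n trivial. *)
by case/(dvdn_pfactor _ _ (isT : prime 2)) => -[|[|[|//]]] _ oab //;
  case/negP: an; rewrite -x2 -order_dvdn oab.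
Qed.

(** A subgroup of a cyclic group is determined by its order, and every divisor of the group order
    occurs, so H |-> [#|H|] is a bijection onto the divisors. *)
Lemma card_cyclic_subgroups_cyclic (gT : finGroupType) (A : {group gT}) :
  cyclic A -> #|cyclic_subgroups A| = size (divisors #|A|).
Proof.
move=> cA; pose ord (H : {group gT}) := #|H|.
have ord_inj : {in cyclic_subgroups A &, injective ord}.
  move=> H K; rewrite !inE => /andP[sHA _] /andP[sKA _] /eqP.
  by rewrite -(eq_subG_cyclic cA) // => /eqP/group_inj.
rewrite cardE -(size_map ord); apply/perm_size/uniq_perm.
- rewrite map_inj_in_uniq ?enum_uniq // => H K; rewrite !mem_enum; exact: ord_inj.
- exact: divisors_uniq.
move=> d; rewrite -dvdn_divisors //; apply/mapP/idP=> [[H]|].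
  by rewrite mem_enum !inE => /andP[sHA _] ->; apply: cardSg.
case/cyclicP: cA => a defA; rewrite defA => d_dvd.
have [k def_a] := dvdnP d_dvd; exists <[a ^+ k]>%G.
  by rewrite mem_enum !inE cycle_cyclic defA cycleX.
rewrite /ord -[RHS]orderE orderXdiv; last by rewrite orderE def_a dvdn_mulr.
by rewrite orderE def_a mulKn //; move: (cardG_gt0 <[a]>); rewrite def_a; case: (k).
Qed.

Lemma card_cyclic_subgroups_setX (gT hT : finGroupType)
    (G : {group gT}) (H : {group hT}) : coprime #|G| #|H| ->
  #|cyclic_subgroups (setX_group G H)|
    = (#|cyclic_subgroups G| * #|cyclic_subgroups H|)%N.
Proof.
move=> co; rewrite -cardsX.
pose f (KL : {group gT} * {group hT}) := setX_group KL.1 KL.2.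
have f_inj : injective f.
  move=> [K L] [K' L'] /(congr1 val) /= e; congr (_, _); apply/group_inj.
    by rewrite -(morphim_fstX K L) e morphim_fstX.
  by rewrite -(morphim_sndX K L) e morphim_sndX.
rewrite -(card_imset _ f_inj); apply: eq_card => M; rewrite !inE.
apply/andP/imsetP=> [[sM /cyclicP[[x y] defM]] | [[K L]]].
  have /setXP[Gx Hy] : (x, y) \in setX G H by rewrite (subsetP sM) ?defM ?cycle_id.
  exists (<[x]>%G, <[y]>%G); first by rewrite !inE !cycle_subG !cycle_cyclic Gx Hy.
  (* <(x, y)> lies in <x> x <y>, so comparing orders suffices. The projections show that [#[x]] and
     [#[y]] divide the order of (x, y); being coprime, so does their product. *)
  apply/val_inj/eqP; rewrite /= eqEcard defM cycle_subG inE !cycle_id /=.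
  rewrite cardsX -!orderE dvdn_leq ?order_gt0 // Gauss_dvd.
    rewrite (morph_order [morphism of fun u => u.1] (in_setT (x, y))).
    by rewrite (morph_order [morphism of fun u => u.2] (in_setT (x, y))).
  by rewrite (coprime_dvdl _ (coprime_dvdr _ co)) ?order_dvdG.
rewrite !inE /= => /andP[/andP[sK cK] /andP[sL cL]] ->; rewrite setXS //; split=> //.
rewrite (cyclic_dprod (setX_dprod K L)) ?cardsX ?cards1 ?muln1 ?mul1n.
- by rewrite (coprime_dvdl _ (coprime_dvdr _ co)) ?cardSg.
- by rewrite -(isog_cyclic (isog_setX1 _ K)).
by rewrite -(isog_cyclic (isog_set1X _ L)).
Qed.

(** The fibres of x |-> <x> on X are counted: by the second hypothesis, the fibre over <x> consists
    of all generators of <x>, and there are [totient m] of them. *)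
Lemma card_cycles_same_order (gT : finGroupType) (X : {set gT}) (m : nat) :
    {in X, forall x, #[x] = m} ->
    (forall x y, <[x]> = <[y]> -> x \in X -> y \in X) ->
  #|X| = (#|[set <[x]>%G | x in X]| * totient m)%N.
Proof.
move=> oX genX; rewrite -sum1_card (partition_big_imset (fun x => <[x]>%G)) /=.
rewrite -sum_nat_const; apply: eq_bigr => _ /imsetP[x Xx ->].
rewrite -(oX x Xx) totient_gen sum1_card; apply: eq_card => y.
rewrite !inE unfold_in /= /generator -val_eqE /= eq_sym andbC.
by case: eqP => //= /genX->.
Qed.

(** The cyclic subgroups inside A correspond to the divisors of 2n. The others are generated by the
    2n elements of order 4 outside A, two generators for each. *)
Lemma card_cyclic_subgroups_dicyclic (n : nat) (gT : finGroupType) (T : {group gT}) :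
    odd n -> (1 < n)%N -> is_dicyclic n T ->
  #|cyclic_subgroups T| = (n + size (divisors (2 * n)))%N.
Proof.
move=> n_odd n_gt1 dicT.
have [A [sAT cA oA oT oTA]] := dicyclic_structure n_odd n_gt1 dicT.
rewrite -oA -(card_cyclic_subgroups_cyclic cA) addnC.
rewrite -(cardsID (cyclic_subgroups A)) (setIidPr _); last first.
  by apply/subsetP=> H; rewrite !inE => /andP[sHA ->]; rewrite (subset_trans sHA).
congr (_ + _)%N; have -> : cyclic_subgroups T :\: cyclic_subgroups A
    = [set <[x]>%G | x in T :\: A].
  apply/setP=> H; apply/idP/imsetP => [|[x]]; rewrite !inE.
    case/andP=> + /andP[sHT /cyclicP[x defH]]; rewrite defH cycle_cyclic andbT.
    move: sHT; rewrite defH !cycle_subG => Tx Ax; exists x; first by rewrite inE Ax.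
    exact: val_inj.
  by case/andP=> Ax Tx -> /=; rewrite !cycle_subG cycle_cyclic (negPf Ax) Tx.
have := card_cycles_same_order oTA.
rewrite cardsD (setIidPr sAT) oA oT => /(_ _)/eqP.
(* The factors [4 - 2] and [totient 4] both compute to 2 and cancel. What remains is that membership
   in T \ A depends only on the subgroup generated. *)
rewrite -mulnBl mulnC eqn_pmul2r // => eqn; symmetry; apply/eqP/eqn.
by move=> x y exy; rewrite !inE -!cycle_subG exy.
Qed.

End CyclicSubgroups.

Local Open Scope ring_scope.

Theorem proposition5p1 (p q : nat) (gT hT : finGroupType)
    (T : {group gT}) (C : {group hT}) :
  prime p -> prime q -> (p < q)%N -> odd p ->
  is_dicyclic q T ->
  cyclic C -> #|C| = p ->
  (forall t : int,
     #|cyclic_subgroups (setX_group T C)|%:Z = #|setX_group T C|%:Z - t ->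
     t = 2 * q%:Z * (2 * p%:Z - 1) - 8) /\
  #|cyclic_subgroups (setX_group T C)|%:Z =
    4 * p%:Z * q%:Z - (2 * q%:Z * (2 * p%:Z - 1) - 8).
Proof.
move=> p_pr q_pr lt_pq p_odd dicT cC oC.
(* The bound p < q excludes q = 2; the structure of T used below relies on q being odd. *)
have q_gt2 : (2 < q)%N by apply: leq_ltn_trans (prime_gt1 p_pr) lt_pq.
have q_odd : odd q by case: (even_prime q_pr) => [q2|//]; rewrite q2 in q_gt2.
have oT : #|T| = (4 * q)%N.
  by have [A []] := dicyclic_structure q_odd (prime_gt1 q_pr) dicT.
have co : coprime #|T| #|C|.
  rewrite oT oC coprimeMl -[4%N]/(2 ^ 2)%N coprimeXl ?coprime2n //=.
  by rewrite coprime_sym prime_coprime ?dvdn_prime2 // ltn_eqF.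
rewrite card_cyclic_subgroups_setX // (card_cyclic_subgroups_cyclic cC) oC.
rewrite (card_cyclic_subgroups_dicyclic q_odd (prime_gt1 q_pr) dicT) cardsX oT oC.
(* The count becomes (q + 4) * 2 and the group order 4 * q * p, which leaves only integer
   arithmetic. *)
rewrite (size_divisors_prime p_pr) size_divisors_double_prime //.
by split=> [t|]; lia.
Qed.
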